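(* Let $\theta\in\mathbb{R}$, let $A=\mathcal{O}_\theta(\mathbb{T}^2)$ be the noncommutative algebraic 2-torus with right $H$-coaction $\Delta_A$ of $H=\mathbb{C}[t,t^{-1}]$ given by $\Delta_A(u)=u\otimes t$, $\Delta_A(v)=v\otimes t^{-1}$, and let $\Omega^\bullet(A)$, $\Omega^\bullet(H)$ be the differential calculi on $A$ and $H$ described in the context. Then the differential calculus $\Omega^\bullet(A)$ is complete, i.e. $\Delta_A$ extends to a morphism of differential graded algebras $\Delta_A^\wedge:\Omega^\bullet(A)\to\Omega^\bullet(A)\otimes\Omega^\bullet(H)$.
   Context: A differential calculus on an algebra $A$ is a differential $\mathbb{N}_0$-graded algebra $(\Omega^\bullet,\wedge,\mathrm{d})$ (so $\mathrm{d}^2=0$ and the graded Leibniz rule holds) with $\Omega^0=A$ and $\Omega^k=\mathrm{span}\{a^0\mathrm{d}a^1\wedge\cdots\wedge\mathrm{d}a^k : a^i\in A\}$. Morphisms of differential graded algebras are degree-preserving algebra maps commuting with the differentials. A tensor product of differential graded algebras carries the product $(\omega\otimes\eta)(\omega'\otimes\eta')=(-1)^{|\eta||\omega'|}(\omega\wedge\omega')\otimes(\eta\wedge\eta')$ and the differential $\omega\otimes\eta\mapsto \mathrm{d}\omega\otimes\eta+(-1)^{|\omega|}\omega\otimes\mathrm{d}\eta$. If $A$ is a right $H$-comodule algebra with coaction $\Delta_A$, and a calculus $\Omega^\bullet(H)$ on $H$ is given, a differential calculus $\Omega^\bullet(A)$ is complete if $\Delta_A:A\to A\otimes H$ extends to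 a morphism of differential graded algebras $\Omega^\bullet(A)\to\Omega^\bullet(A)\otimes\Omega^\bullet(H)$. The Hopf algebra $H=\mathcal{O}(\mathrm{U}(1))=\mathbb{C}[t,t^{-1}]$ has $\Delta(t)=t\otimes t$, $\epsilon(t)=1$, $S(t)=t^{-1}$. Its calculus has $\Omega^1(H)=H\,\mathrm{d}t$ free of rank one with $t\,\mathrm{d}t=\mathrm{d}t\,t$, $t^{-1}\mathrm{d}t=\mathrm{d}t\,t^{-1}$, and $\Omega^k(H)=0$ for $k\geq 2$. The algebra $A$ is generated over $\mathbb{C}$ by $u,u^{-1},v,v^{-1}$ (mutually inverse pairs) with relation $vu=e^{i\theta}uv$; $\Delta_A$ is the algebra map determined by $u\mapsto u\otimes t$, $v\mapsto v\otimes t^{-1}$. Its calculus is: $\Omega^1(A)$ is the free left $A$-module on $\mathrm{d}u,\mathrm{d}v$ with bimodule relations $\mathrm{d}u\,u=u\,\mathrm{d}u$, $\mathrm{d}v\,v=v\,\mathrm{d}v$, $\mathrm{d}u\,v=e^{-i\theta}v\,\mathrm{d}u$, $\mathrm{d}v\,u=e^{i\theta}u\,\mathrm{d}v$; $\Omega^2(A)$ is the free left $A$-module on $\mathrm{d}u\wedge\mathrm{d}v$, with $\mathrm{d}u\wedge\mathrm{d}v+e^{-i\theta}\mathrm{d}v\wedge\mathrm{d}u=0$, $\mathrm{d}u\wedge\mathrm{d}u=0=\mathrm{d}v\wedge\mathrm{d}v$; and $\Omega^k(A)=0$ for $k\geq3$. *)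

(* Defs.v *)
From HB Require Import structures.
From mathcomp Require Import all_boot all_order all_algebra.
From mathcomp Require Import complex.
From mathcomp Require Import boolp classical_sets reals trigo.

Set Implicit Arguments.
Unset Strict Implicit.
Unset Printing Implicit Defensive.

Import GRing.Theory.
Local Open Scope ring_scope.
Local Open Scope quotient_scope.

Section LinearForm.
Variables (K : fieldType) (V : lmodType K).

Lemma exists_linear_form (v : V) : v != 0 ->
  exists2 f : V -> K, (forall c x y, f (c *: x + y) = c * f x + f y) & f v = 1.
Proof.
move=> v0.
pose P (S : set V) := (forall c x y, S x -> S y -> S (c *: x + y)) /\ ~ S v.
have [S [[Scl Sv] Smax]] : exists A, P A /\ forall B, (A `<` B)%classic -> ~ P B.
  apply: Zorn_bigcup => F FP Ftot; split; last first.
    by move=> [X FX Xv]; have [] := FP _ FX.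
  move=> c x y [X FX Xx] [Y FY Yy].
  have [XY|YX] := Ftot _ _ FX FY.
    by exists Y => //; apply: (FP _ FY).1 => //; apply: XY.
  by exists X => //; apply: (FP _ FX).1 => //; apply: YX.
have S0 : S 0.
  apply: contrapT => nS0; apply: (Smax (S `|` [set 0])%classic).
    split; first by move=> x Sx; left.
    by move=> h; apply: nS0; apply: h; right.
  have SE x : ~ S x.
    by move=> Sx; apply: nS0; rewrite -(subrr x) addrC -scaleN1r; apply: Scl.
  split; last by move=> [//|] /= vE; rewrite vE eqxx in v0.
  move=> c x y [/SE//|->] [/SE//|->]; right.
  by rewrite /= scaler0 addr0.
have SZ c x : S x -> S (c *: x) by move=> Sx; rewrite -[_ *: _]addr0; apply: Scl.
have SD x y : S x -> S y -> S (x + y).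
  by move=> Sx Sy; rewrite -[x]scale1r; apply: Scl.
have SB x y : S x -> S y -> S (x - y).
  by move=> Sx Sy; apply: SD => //; rewrite -scaleN1r; apply: SZ.
have ex x : exists c, S (x - c *: v).
  have [Sx|nSx] := pselect (S x); first by exists 0; rewrite scale0r subr0.
  pose S' : set V := (fun w => exists2 c, S (w - c *: x) & True).
  have SS' : (S `<` S')%classic.
    split; first by move=> z Sz; exists 0; rewrite ?scale0r ?subr0.
    by move=> h; apply: nSx; apply: h; exists 1; rewrite // scale1r subrr.
  have : S' v.
    apply: contrapT => nS'v; apply: (Smax _ SS'); split=> //.
    move=> c y z [a Sa _] [b Sb _]; exists (c * a + b) => //.
    rewrite scalerDl opprD addrACA -scalerA -scalerBr; exact: Scl.
  move=> [c Sc _]; have c0 : c != 0.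
    by apply: contra_notN Sv => /eqP c0; move: Sc; rewrite c0 scale0r subr0.
  exists c^-1; have := SZ (- c^-1) _ Sc.
  by rewrite scalerBr !scaleNr scalerA mulVf // scale1r opprK addrC.
have uniq x c d : S (x - c *: v) -> S (x - d *: v) -> c = d.
  move=> Sc Sd; apply: contrapT => /eqP ncd; apply: Sv.
  have := SZ (c - d)^-1 _ (SB _ _ Sd Sc).
  rewrite opprD opprK addrACA subrr add0r addrC -scalerBl scalerA.
  by rewrite mulVf ?scale1r // subr_eq0.
pose f x := sval (cid (ex x)).
have fP x : S (x - f x *: v) by rewrite /f; case: cid.
exists f => [c x y|].
  apply: (uniq (c *: x + y)) => //.
  have := Scl c _ _ (fP x) (fP y).
  by rewrite scalerBr scalerA addrACA -opprD -scalerDl.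
by apply: (uniq v) => //; rewrite scale1r subrr.
Qed.

End LinearForm.

(* The tensor product over K: formal sums of pairs, represented as lists,     *)
(* modulo the congruence generated by bilinearity.                            *)
Section Tensor.
Variables (K : fieldType) (V W : lmodType K).

Inductive tens_eqv : seq (V * W) -> seq (V * W) -> Prop :=
| tens_refl s : tens_eqv s s
| tens_sym s1 s2 : tens_eqv s1 s2 -> tens_eqv s2 s1
| tens_trans s1 s2 s3 : tens_eqv s1 s2 -> tens_eqv s2 s3 -> tens_eqv s1 s3
| tens_cat s1 s2 r1 r2 :
    tens_eqv s1 s2 -> tens_eqv r1 r2 -> tens_eqv (s1 ++ r1) (s2 ++ r2)
| tens_catC s1 s2 : tens_eqv (s1 ++ s2) (s2 ++ s1)
| tens_0 y : tens_eqv [:: (0, y)] [::]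
| tens_Dl x x' y : tens_eqv [:: (x + x', y)] [:: (x, y); (x', y)]
| tens_Dr x y y' : tens_eqv [:: (x, y + y')] [:: (x, y); (x, y')]
| tens_Z c x y : tens_eqv [:: (c *: x, y)] [:: (x, c *: y)].

Definition tens_rel (s1 s2 : seq (V * W)) : bool := `[< tens_eqv s1 s2 >].

Lemma tens_rel_equiv : equiv_class_of tens_rel.
Proof.
split=> [s|s1 s2|s2 s1 s3].
- by apply/asboolP; apply: tens_refl.
- by apply/asboolP/asboolP; apply: tens_sym.
- move=> /asboolP h1 /asboolP h2; apply/asboolP.
  exact: tens_trans h1 h2.
Qed.

Canonical tens_equiv := EquivRelPack tens_rel_equiv.

Definition tens : Type := {eq_quot tens_equiv}.
HB.instance Definition _ := Choice.on tens.
HB.instance Definition _ := EqQuotient.on tens.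

Definition tens_of (s : seq (V * W)) : tens := \pi_tens s.
Definition tensor (x : V) (y : W) : tens := tens_of [:: (x, y)].

Lemma tens_ofP s1 s2 : tens_of s1 = tens_of s2 <-> tens_eqv s1 s2.
Proof.
split=> [/eqmodP/asboolP//|h].
by apply/eqmodP/asboolP.
Qed.

Lemma tens_reprK x : tens_of (repr x) = x.
Proof. exact: reprK. Qed.

Definition tens_add (x y : tens) := tens_of (repr x ++ repr y).
Definition tens_scale (c : K) (x : tens) :=
  tens_of [seq (c *: p.1, p.2) | p <- repr x].
Definition tens_opp := tens_scale (-1).

Lemma tens_ofD s1 s2 : tens_add (tens_of s1) (tens_of s2) = tens_of (s1 ++ s2).
Proof. by apply/tens_ofP; apply: tens_cat; apply/tens_ofP; rewrite tens_reprK. Qed.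

Lemma tens_eqv_scale c s1 s2 : tens_eqv s1 s2 ->
  tens_eqv [seq (c *: p.1, p.2) | p <- s1] [seq (c *: p.1, p.2) | p <- s2].
Proof.
elim=> {s1 s2} /=.
- by move=> s; apply: tens_refl.
- by move=> s1 s2 _; apply: tens_sym.
- by move=> s1 s2 s3 _ h1 _; apply: tens_trans h1.
- by move=> s1 s2 r1 r2 _ h1 _ h2; rewrite !map_cat; apply: tens_cat.
- by move=> s1 s2; rewrite !map_cat; apply: tens_catC.
- by move=> y; rewrite scaler0; apply: tens_0.
- by move=> x x' y; rewrite scalerDr; apply: tens_Dl.
- by move=> x y y'; apply: tens_Dr.
- by move=> d x y; rewrite scalerA mulrC -scalerA; apply: tens_Z.
Qed.

Lemma tens_ofZ c s :
  tens_scale c (tens_of s) = tens_of [seq (c *: p.1, p.2) | p <- s].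
Proof.
by apply/tens_ofP; apply: tens_eqv_scale; apply/tens_ofP; rewrite tens_reprK.
Qed.

Lemma tens_addA : associative tens_add.
Proof.
move=> x y z; rewrite -[x]tens_reprK -[y]tens_reprK -[z]tens_reprK.
by rewrite !tens_ofD catA.
Qed.

Lemma tens_addC : commutative tens_add.
Proof.
move=> x y; rewrite -[x]tens_reprK -[y]tens_reprK !tens_ofD.
by apply/tens_ofP; apply: tens_catC.
Qed.

Lemma tens_add0 : left_id (tens_of [::]) tens_add.
Proof. by move=> x; rewrite -[x]tens_reprK tens_ofD. Qed.

Lemma tens_scaleDl x : {morph tens_scale^~ x : a b / a + b >-> tens_add a b}.
Proof.
move=> a b /=; rewrite -[x]tens_reprK !tens_ofZ tens_ofD; apply/tens_ofP.
elim: (repr x) => [|[v w] s ih] /=; first exact: tens_refl.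
rewrite -cat1s -[(a *: v, w) :: _]cat1s -[(b *: v, w) :: _]cat1s.
have h := tens_cat (tens_Dl (a *: v) (b *: v) w) ih.
rewrite scalerDl; apply: tens_trans h _.
rewrite -[[:: _; _]]/([:: _] ++ [:: _]) -!catA.
apply: tens_cat; first exact: tens_refl.
rewrite !catA; apply: tens_cat; last exact: tens_refl.
exact: tens_catC.
Qed.

Lemma tens_scale0 x : tens_scale 0 x = tens_of [::].
Proof.
rewrite -[x]tens_reprK tens_ofZ; apply/tens_ofP.
elim: (repr x) => [|[v w] s ih] /=; first exact: tens_refl.
by rewrite -cat1s -[[::]]cats0 scale0r; apply: tens_cat => //; apply: tens_0.
Qed.

Lemma tens_scale1 : left_id 1 tens_scale.
Proof.
move=> x; rewrite -[x]tens_reprK tens_ofZ; congr tens_of.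
by rewrite -[RHS]map_id; apply: eq_map => -[v w]; rewrite /= scale1r.
Qed.

Lemma tens_addN : left_inverse (tens_of [::]) tens_opp tens_add.
Proof.
move=> x; rewrite /tens_opp -{2}[x]tens_scale1 -tens_scaleDl.
by rewrite addNr tens_scale0.
Qed.

HB.instance Definition _ :=
  GRing.isZmodule.Build tens tens_addA tens_addC tens_add0 tens_addN.

Lemma tens_scaleA a b v : tens_scale a (tens_scale b v) = tens_scale (a * b) v.
Proof.
rewrite -[v]tens_reprK !tens_ofZ -map_comp; congr tens_of.
by apply: eq_map => -[x y]; rewrite /= scalerA.
Qed.

Lemma tens_scaleDr : right_distributive tens_scale +%R.
Proof.
move=> a x y; rewrite -[x]tens_reprK -[y]tens_reprK.
by rewrite [_ + _]tens_ofD !tens_ofZ [RHS]tens_ofD map_cat.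
Qed.

HB.instance Definition _ := GRing.Zmodule_isLmodule.Build K tens
  tens_scaleA tens_scale1 tens_scaleDr tens_scaleDl.

Lemma tens_ofE s : tens_of s = \sum_(p <- s) tensor p.1 p.2.
Proof.
elim: s => [|[x y] s ih]; first by rewrite big_nil.
by rewrite big_cons -ih [RHS]tens_ofD.
Qed.

Lemma tensorDl x x' y : tensor (x + x') y = tensor x y + tensor x' y.
Proof. by rewrite [RHS]tens_ofD; apply/tens_ofP; apply: tens_Dl. Qed.

Lemma tensorDr x y y' : tensor x (y + y') = tensor x y + tensor x y'.
Proof. by rewrite [RHS]tens_ofD; apply/tens_ofP; apply: tens_Dr. Qed.

Lemma tensorZl c x y : tensor (c *: x) y = c *: tensor x y.
Proof. by rewrite [RHS]tens_ofZ. Qed.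

Lemma tensorZr c x y : tensor x (c *: y) = c *: tensor x y.
Proof. by rewrite -tensorZl; apply/tens_ofP/tens_sym/tens_Z. Qed.

Lemma tens_ind (P : tens -> Prop) :
  P 0 -> (forall x y, P x -> P y -> P (x + y)) -> (forall x y, P (tensor x y)) ->
  forall x, P x.
Proof.
move=> P0 PD Pt x; rewrite -[x]tens_reprK tens_ofE.
by elim: (repr x) => [|p s ih]; rewrite ?big_nil // big_cons; apply: PD.
Qed.

Definition tens_bilinear (U : lmodType K) (f : V -> W -> U) : Prop :=
  (forall y, linear (f^~ y)) /\ (forall x, linear (f x)).

(* The linear map determined by a bilinear map f; it is meaningless (but      *)
(* total) when f is not bilinear.                                             *)
Definition tens_lift (U : lmodType K) (f : V -> W -> U) (x : tens) : U :=
  \sum_(p <- repr x) f p.1 p.2.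

Section Lift.
Variables (U : lmodType K) (f : V -> W -> U).
Hypothesis fbil : tens_bilinear f.

Lemma tens_bil0l y : f 0 y = 0.
Proof.
have := fbil.1 y (-1) 0 0; rewrite scaler0 addr0 scaleN1r addNr.
exact.
Qed.

Lemma tens_bil0r x : f x 0 = 0.
Proof.
have := fbil.2 x (-1) 0 0; rewrite scaler0 addr0 scaleN1r addNr.
exact.
Qed.

Lemma tens_lift_of s : tens_lift f (tens_of s) = \sum_(p <- s) f p.1 p.2.
Proof.
have : tens_eqv (repr (tens_of s)) s by apply/tens_ofP; rewrite tens_reprK.
rewrite /tens_lift; move: (repr _) => r.
elim=> {r s} //= [s1 s2 s3 _ -> _ -> //|s1 s2 r1 r2 _ h1 _ h2|s1 s2|y|x x' y|x y y'|c x y].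
- by rewrite !big_cat h1 h2.
- by rewrite !big_cat /= addrC.
- by rewrite big_seq1 big_nil tens_bil0l.
- by rewrite !big_cons !big_nil !addr0 /= -{1}[x]scale1r fbil.1 scale1r.
- by rewrite !big_cons !big_nil !addr0 /= -{1}[y]scale1r fbil.2 scale1r.
- rewrite !big_seq1 /= -[c *: x]addr0 -[c *: y]addr0 fbil.1 fbil.2.
  by rewrite tens_bil0l tens_bil0r.
Qed.

Lemma tens_liftE x y : tens_lift f (tensor x y) = f x y.
Proof. by rewrite tens_lift_of big_seq1. Qed.

Lemma tens_liftP : linear (tens_lift f).
Proof.
move=> c x y; rewrite -[x]tens_reprK -[y]tens_reprK.
rewrite [_ *: _]tens_ofZ [_ + _]tens_ofD !tens_lift_of big_cat /=.
congr (_ + _); rewrite big_map /= scaler_sumr; apply: eq_bigr => p _.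
by rewrite -[_ *: p.1]addr0 fbil.1 tens_bil0l addr0.
Qed.

End Lift.

Lemma tensor_bilinear : tens_bilinear tensor.
Proof.
by split=> z c x y; rewrite /= ?tensorDl ?tensorDr ?tensorZl ?tensorZr.
Qed.

Lemma tensor_neq0 x y : x != 0 -> y != 0 -> tensor x y != 0.
Proof.
move=> /exists_linear_form[f fl fx] /exists_linear_form[g gl gy].
apply/eqP => xy0.
have bil : tens_bilinear (U := K^o) (fun x y => f x * g y).
  split=> z c a b /=.
    by rewrite fl mulrDl -mulrA.
  by rewrite gl mulrDr [c *: _]mulrCA.
have := tens_liftE bil x y; rewrite xy0 fx gy mulr1.
rewrite -[0]/(tens_of [::]) tens_lift_of // big_nil => /esym/eqP.
by rewrite (negbTE (oner_neq0 _)).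
Qed.

End Tensor.

Arguments tens {K} (V W)%_type_scope.
Notation "V ⊗ W" := (tens V W) (at level 40, left associativity) : type_scope.
Notation "x ⊗ y" := (tensor x y) (at level 40, left associativity) : ring_scope.

Section TensorMaps.
Variable K : fieldType.

Definition tens_map (V W V' W' : lmodType K) (f : V -> V') (g : W -> W') :
    V ⊗ W -> V' ⊗ W' :=
  tens_lift (fun x y => f x ⊗ g y).

Definition tens_assoc (V W U : lmodType K) : (V ⊗ W) ⊗ U -> V ⊗ (W ⊗ U) :=
  tens_lift (fun x u => tens_lift (fun v w => v ⊗ (w ⊗ u)) x).

Lemma linear_add (V W : lmodType K) (f : V -> W) :
  linear f -> {morph f : x y / x + y}.
Proof. by move=> fl x y; rewrite -[x]scale1r fl !scale1r. Qed.

Lemma linear_zero (V W : lmodType K) (f : V -> W) : linear f -> f 0 = 0.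
Proof.
by move=> fl; have := fl (-1) 0 0; rewrite scaler0 addr0 scaleN1r addNr.
Qed.

Lemma linear_scale (V W : lmodType K) (f : V -> W) :
  linear f -> forall c x, f (c *: x) = c *: f x.
Proof. by move=> fl c x; rewrite -[c *: x]addr0 fl linear_zero // addr0. Qed.

End TensorMaps.

Section TensorMul.
Variables (K : fieldType) (A B : lmodType K).
Variable m : A -> B -> A -> B -> A ⊗ B.
Hypothesis mbil1 : forall a' b', tens_bilinear (fun a b => m a b a' b').
Hypothesis mbil2 : forall a b, tens_bilinear (m a b).

(* The bilinear operation on A ⊗ B with (a ⊗ b)(a' ⊗ b') = m a b a' b'. *)
Definition tens_mul (x y : A ⊗ B) : A ⊗ B :=
  tens_lift (fun a b => tens_lift (m a b) y) x.

Lemma tens_mul_bil y : tens_bilinear (fun a b => tens_lift (m a b) y).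
Proof.
split=> z c x x' /=; rewrite /tens_lift scaler_sumr -big_split /=;
  apply: eq_bigr => p _; first by rewrite (mbil1 _ _).1.
by rewrite (mbil1 _ _).2.
Qed.

Lemma tens_mulE a b a' b' : tens_mul (a ⊗ b) (a' ⊗ b') = m a b a' b'.
Proof. by rewrite /tens_mul (tens_liftE (tens_mul_bil _)) tens_liftE. Qed.

Lemma tens_mul_linl y : linear (tens_mul^~ y).
Proof. exact: tens_liftP (tens_mul_bil y). Qed.

Lemma tens_mul_linr x : linear (tens_mul x).
Proof.
move=> c y y'; rewrite /tens_mul /tens_lift scaler_sumr -big_split /=.
by apply: eq_bigr => p _; apply: tens_liftP.
Qed.

Lemma tens_mulDl : left_distributive tens_mul +%R.
Proof. by move=> x y z; apply: (linear_add (tens_mul_linl z)). Qed.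

Lemma tens_mulDr : right_distributive tens_mul +%R.
Proof. by move=> z x y; apply: (linear_add (tens_mul_linr z)). Qed.

Lemma tens_mul_scalel c x y : c *: tens_mul x y = tens_mul (c *: x) y.
Proof. by rewrite (linear_scale (tens_mul_linl y)). Qed.

Lemma tens_mul_scaler c x y : c *: tens_mul x y = tens_mul x (c *: y).
Proof. by rewrite (linear_scale (tens_mul_linr x)). Qed.

Lemma tens_mul0l x : tens_mul 0 x = 0.
Proof. exact: (linear_zero (tens_mul_linl x)). Qed.

Lemma tens_mul0r x : tens_mul x 0 = 0.
Proof. exact: (linear_zero (tens_mul_linr x)). Qed.

End TensorMul.

Section TensorAlgebra.
Variables (K : fieldType) (A B : algType K).

Let m (a : A) (b : B) (a' : A) (b' : B) : A ⊗ B := (a * a') ⊗ (b * b').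

Lemma tens_alg_bil1 a' b' : tens_bilinear (fun a b => m a b a' b').
Proof.
split=> z c x y; rewrite /m mulrDl -scalerAl ?(tensorDl, tensorDr).
  by rewrite tensorZl.
by rewrite tensorZr.
Qed.

Lemma tens_alg_bil2 a b : tens_bilinear (m a b).
Proof.
split=> z c x y; rewrite /m mulrDr -scalerAr ?(tensorDl, tensorDr).
  by rewrite tensorZl.
by rewrite tensorZr.
Qed.

Definition tens_alg_mul : A ⊗ B -> A ⊗ B -> A ⊗ B := tens_mul m.

Lemma tens_alg_mulE a b a' b' :
  tens_alg_mul (a ⊗ b) (a' ⊗ b') = (a * a') ⊗ (b * b').
Proof. exact: (tens_mulE tens_alg_bil1 tens_alg_bil2). Qed.

Let mulDl := tens_mulDl tens_alg_bil1 : left_distributive tens_alg_mul +%R.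
Let mulDr := tens_mulDr tens_alg_bil2 : right_distributive tens_alg_mul +%R.
Let mul0l := tens_mul0l tens_alg_bil1 : left_zero 0 tens_alg_mul.
Let mul0r := tens_mul0r tens_alg_bil2 : right_zero 0 tens_alg_mul.

Lemma tens_alg_mulA : associative tens_alg_mul.
Proof.
move=> x y z; elim/tens_ind: x => [|x x' hx hx'|a b].
- by rewrite !mul0l.
- by rewrite !mulDl hx hx'.
elim/tens_ind: y => [|y y' hy hy'|a' b'].
- by rewrite mul0l !mul0r mul0l.
- by rewrite mulDl !mulDr hy hy' mulDl.
elim/tens_ind: z => [|z z' hz hz'|a'' b''].
- by rewrite !mul0r.
- by rewrite !mulDr hz hz'.
by rewrite !tens_alg_mulE !mulrA.
Qed.

Lemma tens_alg_mul1r : left_id (1 ⊗ 1) tens_alg_mul.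
Proof.
elim/tens_ind => [|x y hx hy|a b]; first by rewrite mul0r.
  by rewrite mulDr hx hy.
by rewrite tens_alg_mulE !mul1r.
Qed.

Lemma tens_alg_mulr1 : right_id (1 ⊗ 1) tens_alg_mul.
Proof.
elim/tens_ind => [|x y hx hy|a b]; first by rewrite mul0l.
  by rewrite mulDl hx hy.
by rewrite tens_alg_mulE !mulr1.
Qed.

Lemma tens_alg_oner_neq0 : (1 : A) ⊗ (1 : B) != 0.
Proof. by apply: tensor_neq0; apply: oner_neq0. Qed.

HB.instance Definition _ := GRing.Zmodule_isNzRing.Build (tens A B)
  tens_alg_mulA tens_alg_mul1r tens_alg_mulr1 mulDl mulDr tens_alg_oner_neq0.
HB.instance Definition _ := GRing.Lmodule_isLalgebra.Build K (tens A B)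
  (tens_mul_scalel tens_alg_bil1).
HB.instance Definition _ := GRing.Lalgebra_isAlgebra.Build K (tens A B)
  (tens_mul_scaler tens_alg_bil2).

Lemma tensorM (a a' : A) (b b' : B) : (a ⊗ b) * (a' ⊗ b') = (a * a') ⊗ (b * b').
Proof. exact: tens_alg_mulE. Qed.

End TensorAlgebra.

(* Differential graded algebras: the total algebra together with the          *)
(* projections gpart n onto its homogeneous components.                       *)
HB.mixin Record isDGAlgebra (K : fieldType) Om of GRing.Algebra K Om := {
  gpart : nat -> Om -> Om;
  gdiff : Om -> Om;
  gpart_linear : forall n, linear (gpart n);
  gpart_part : forall m n w, gpart m (gpart n w) = if m == n then gpart n w else 0;
  gpart_sum : forall w, exists N, w = \sum_(n < N) gpart n w;
  gpart1 : gpart 0 1 = 1;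
  gpartM : forall m n w w',
    gpart (m + n)%N (gpart m w * gpart n w') = gpart m w * gpart n w';
  gdiff_linear : linear gdiff;
  gdiff_part : forall n w, gpart n.+1 (gdiff (gpart n w)) = gdiff (gpart n w);
  gdiffK : forall w, gdiff (gdiff w) = 0;
  gdiffM : forall n w w', gdiff (gpart n w * w') =
    gdiff (gpart n w) * w' + (-1) ^+ n *: (gpart n w * gdiff w')
}.

#[short(type="dgAlgType")]
HB.structure Definition DGAlgebra (K : fieldType) :=
  { Om of isDGAlgebra K Om & GRing.Algebra K Om }.

Definition homog (K : fieldType) (Om : dgAlgType K) (n : nat) (w : Om) : Prop :=
  gpart n w = w.

Section DGTheory.
Variables (K : fieldType) (Om : dgAlgType K).
Implicit Types w : Om.

Definition gbound w : nat := sval (cid (gpart_sum w)).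

Lemma gboundE w : w = \sum_(n < gbound w) gpart n w.
Proof. by rewrite /gbound; case: cid. Qed.

Lemma gpart_wide w n : (gbound w <= n)%N -> gpart n w = 0.
Proof.
move=> h; rewrite [w in LHS]gboundE.
have gD := linear_add (@gpart_linear K Om n).
have g0 := linear_zero (@gpart_linear K Om n).
rewrite (big_morph _ gD g0) big1 // => i _.
by rewrite gpart_part gtn_eqF // (leq_trans (ltn_ord i)).
Qed.

Lemma gpart_homog n w : homog n (gpart n w).
Proof. by rewrite /homog gpart_part eqxx. Qed.

Lemma homog_part m n w : homog n w -> gpart m w = if m == n then w else 0.
Proof. by move=> h; rewrite -{1}h gpart_part h. Qed.

Lemma homogM m n w w' : homog m w -> homog n w' -> homog (m + n)%N (w * w').
Proof. by move=> h h'; rewrite /homog -{1}h -{1}h' gpartM h h'. Qed.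

Lemma homog_diff n w : homog n w -> homog n.+1 (gdiff w).
Proof. by move=> h; rewrite /homog -{1}h gdiff_part h. Qed.

Lemma homog_diffM n w w' : homog n w ->
  gdiff (w * w') = gdiff w * w' + (-1) ^+ n *: (w * gdiff w').
Proof. by move=> h; rewrite -{1}h gdiffM h. Qed.

(* \sum_n F n w_n, where w_n is the component of degree n of w. *)
Definition gsum (U : lmodType K) (F : nat -> Om -> U) w : U :=
  \sum_(n < gbound w) F n (gpart n w).

Section GSum.
Variables (U : lmodType K) (F : nat -> Om -> U).
Hypothesis Flin : forall n, linear (F n).

Lemma gsum_wide N w : (gbound w <= N)%N -> gsum F w = \sum_(n < N) F n (gpart n w).
Proof.
move=> h; rewrite /gsum (big_ord_widen _ (fun n => F n (gpart n w)) h).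
rewrite big_mkcond; apply: eq_bigr => i _; case: ltnP => // hi.
by rewrite gpart_wide // linear_zero.
Qed.

Lemma gsum_linear : linear (gsum F).
Proof.
move=> c x y; pose N := maxn (gbound (c *: x + y)) (maxn (gbound x) (gbound y)).
rewrite !(@gsum_wide N) ?leq_max ?leqnn ?orbT //.
rewrite scaler_sumr -big_split; apply: eq_bigr => i _ /=.
by rewrite gpart_linear Flin.
Qed.

Lemma gsum_homog n w : homog n w -> gsum F w = F n w.
Proof.
move=> h; rewrite (@gsum_wide (maxn (gbound w) n.+1)) ?leq_max ?leqnn //.
have hn : (n < maxn (gbound w) n.+1)%N by rewrite leq_max leqnn orbT.
rewrite (bigD1 (Ordinal hn)) //= h big1 ?addr0 // => i ni.
rewrite (homog_part _ h) -(inj_eq val_inj) /= in ni *.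
by rewrite (negbTE ni) linear_zero.
Qed.

End GSum.

(* w |-> (-1) ^ (k |w|) w on homogeneous elements, extended linearly. *)
Definition gsign (k : nat) : Om -> Om := gsum (fun n w => (-1) ^+ (k * n) *: w).

Let sign_linear k n : linear (fun w => (-1) ^+ (k * n) *: w).
Proof. by move=> c x y; rewrite scalerDr !scalerA mulrC. Qed.

Lemma gsign_linear k : linear (gsign k).
Proof. exact: gsum_linear (sign_linear k). Qed.

Lemma gsign_homog k n w : homog n w -> gsign k w = (-1) ^+ (k * n) *: w.
Proof. exact: gsum_homog (sign_linear k) _ _. Qed.

End DGTheory.

(* The tensor product of differential graded algebras. It is an alias of the  *)
(* tensor product of the underlying vector spaces, since a DGA also has the   *)
(* unsigned product of its underlying algebra.                                *)
Definition gtens (K : fieldType) (Om Om' : dgAlgType K) : Type := tens Om Om'.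

Section GradedTensor.
Variables (K : fieldType) (P Q : dgAlgType K).
Local Notation T := (gtens P Q).

HB.instance Definition _ := GRing.Lmodule.on T.

Let tensor' (x : P) (y : Q) : T := x ⊗ y.
Local Notation "x ⊗' y" := (tensor' x y) (at level 40, left associativity).

Lemma gtens_ind (S : T -> Prop) :
  S 0 -> (forall x y, S x -> S y -> S (x + y)) ->
  (forall i j w e, homog i w -> homog j e -> S (w ⊗' e)) -> forall x, S x.
Proof.
move=> S0 SD Sh; apply: tens_ind => // w e.
rewrite (gboundE w) (gboundE e) -/(tensor' _ _).
have Dl z : {morph (fun x => x ⊗' z) : x y / x + y} by move=> *; apply: tensorDl.
have Dr z : {morph tensor' z : x y / x + y} by move=> *; apply: tensorDr.
have z0l z : 0 ⊗' z = 0 by apply: linear_zero ((tensor_bilinear _ _).1 z).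
have z0r z : z ⊗' 0 = 0 by apply: linear_zero ((tensor_bilinear _ _).2 z).
rewrite (big_morph _ (Dl _) (z0l _)); apply: big_ind => // i _.
rewrite (big_morph _ (Dr _) (z0r _)); apply: big_ind => // j _.
by apply: Sh; apply: gpart_homog.
Qed.

(* (w ⊗ e)(w' ⊗ e') = (-1) ^ (|e| |w'|) (w w') ⊗ (e e') *)
Let m (w : P) (e : Q) (w' : P) (e' : Q) : T :=
  gsum (fun k e_k => (w * gsign k w') ⊗' (e_k * e')) e.

Let m_lin w w' e' k : linear (fun e_k => (w * gsign k w') ⊗' (e_k * e')).
Proof.
move=> c x y; rewrite mulrDl -scalerAl.
by rewrite /tensor' tensorDr tensorZr.
Qed.

Let mE w e w' e' i j : homog i e -> homog j w' ->
  m w e w' e' = (-1) ^+ (i * j) *: (w * w') ⊗' (e * e').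
Proof.
move=> he hw'; rewrite /m (gsum_homog _ he) // (gsign_homog _ hw').
by rewrite -scalerAr.
Qed.

Lemma gtens_bil1 w' e' : tens_bilinear (fun w e => m w e w' e').
Proof.
split=> [e|w]; last exact: gsum_linear.
move=> c x y; rewrite /m /gsum scaler_sumr -big_split; apply: eq_bigr => i _ /=.
by rewrite mulrDl -scalerAl /tensor' tensorDl tensorZl.
Qed.

Lemma gtens_bil2 w e : tens_bilinear (m w e).
Proof.
split=> z c x y; rewrite /m /gsum scaler_sumr -big_split;
  apply: eq_bigr => i _ /=.
  by rewrite gsign_linear mulrDr -scalerAr /tensor' tensorDl tensorZl.
by rewrite mulrDr -scalerAr /tensor' tensorDr tensorZr.
Qed.

Definition gtens_mul : T -> T -> T := tens_mul m.

Lemma gtens_mulE w e w' e' i j : homog i e -> homog j w' ->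
  gtens_mul (w ⊗' e) (w' ⊗' e') = (-1) ^+ (i * j) *: ((w * w') ⊗' (e * e')).
Proof.
move=> he hw'; rewrite /gtens_mul (tens_mulE gtens_bil1 gtens_bil2) (mE _ _ he hw').
by rewrite /tensor' tensorZl.
Qed.

Let gmulDl := tens_mulDl gtens_bil1 : left_distributive gtens_mul +%R.
Let gmulDr := tens_mulDr gtens_bil2 : right_distributive gtens_mul +%R.
Let gmul0l := tens_mul0l gtens_bil1 : left_zero 0 gtens_mul.
Let gmul0r := tens_mul0r gtens_bil2 : right_zero 0 gtens_mul.
Let gmulZl c x y : gtens_mul (c *: x) y = c *: gtens_mul x y.
Proof. exact: esym (tens_mul_scalel gtens_bil1 c x y). Qed.
Let gmulZr c x y : gtens_mul x (c *: y) = c *: gtens_mul x y.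
Proof. exact: esym (tens_mul_scaler gtens_bil2 c x y). Qed.

Lemma gtens_mulA : associative gtens_mul.
Proof.
move=> x y z; elim/gtens_ind: x => [|x x' hx hx'|i j a b ha hb].
- by rewrite !gmul0l.
- by rewrite !gmulDl hx hx'.
elim/gtens_ind: y => [|y y' hy hy'|i' j' a' b' ha' hb'].
- by rewrite gmul0l !gmul0r gmul0l.
- by rewrite gmulDl !gmulDr hy hy' gmulDl.
elim/gtens_ind: z => [|z z' hz hz'|i'' j'' a'' b'' ha'' hb''].
- by rewrite !gmul0r.
- by rewrite !gmulDr hz hz'.
rewrite (gtens_mulE _ _ hb' ha'') (gtens_mulE _ _ hb ha') gmulZl gmulZr.
rewrite (gtens_mulE _ _ hb (homogM ha' ha'')) (gtens_mulE _ _ (homogM hb hb') ha'').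
rewrite !mulrA !scalerA -!exprD; congr (_ ^+ _ *: _).
by rewrite mulnDl mulnDr [RHS]addnCA addnC addnCA addnA addnC addnCA.
Qed.

Let homog1 (O : dgAlgType K) : homog 0 (1 : O). Proof. exact: gpart1. Qed.

Lemma gtens_mul1r : left_id (1 ⊗' 1) gtens_mul.
Proof.
elim/gtens_ind => [|x y hx hy|i j a b ha hb]; first by rewrite gmul0r.
  by rewrite gmulDr hx hy.
by rewrite (gtens_mulE _ _ (homog1 _) ha) !mul1r scale1r.
Qed.

Lemma gtens_mulr1 : right_id (1 ⊗' 1) gtens_mul.
Proof.
elim/gtens_ind => [|x y hx hy|i j a b ha hb]; first by rewrite gmul0l.
  by rewrite gmulDl hx hy.
by rewrite (gtens_mulE _ _ hb (homog1 _)) muln0 !mulr1 scale1r.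
Qed.

Lemma gtens_oner_neq0 : 1 ⊗' 1 != 0.
Proof. by apply: tensor_neq0; apply: oner_neq0. Qed.

HB.instance Definition _ := GRing.Zmodule_isNzRing.Build T
  gtens_mulA gtens_mul1r gtens_mulr1 gmulDl gmulDr gtens_oner_neq0.
HB.instance Definition _ := GRing.Lmodule_isLalgebra.Build K T
  (tens_mul_scalel gtens_bil1).
HB.instance Definition _ := GRing.Lalgebra_isAlgebra.Build K T
  (tens_mul_scaler gtens_bil2).

Let part (n : nat) (w : P) (e : Q) : T :=
  \sum_(k < n.+1) gpart k w ⊗' gpart (n - k) e.

Lemma gtens_part_bil n : tens_bilinear (part n).
Proof.
split=> z c x y; rewrite /part scaler_sumr -big_split; apply: eq_bigr => k _ /=.
  by rewrite gpart_linear /tensor' tensorDl tensorZl.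
by rewrite gpart_linear /tensor' tensorDr tensorZr.
Qed.

Definition gtens_part (n : nat) : T -> T := tens_lift (part n).

Lemma gtens_part_linear n : linear (gtens_part n).
Proof. exact: tens_liftP (gtens_part_bil n). Qed.

Lemma gtens_partE n w e i j : homog i w -> homog j e ->
  gtens_part n (w ⊗' e) = if (n == i + j)%N then w ⊗' e else 0.
Proof.
move=> hw he; rewrite /gtens_part (tens_liftE (gtens_part_bil n)) /part.
have z0l z : 0 ⊗' z = 0 by apply: linear_zero ((tensor_bilinear _ _).1 z).
have z0r z : z ⊗' 0 = 0 by apply: linear_zero ((tensor_bilinear _ _).2 z).
case: eqP => [->|nij].
  have hi : (i < (i + j).+1)%N by rewrite ltnS leq_addr.
  rewrite (bigD1 (Ordinal hi)) //= addKn hw he big1 ?addr0 // => k nk.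
  rewrite (homog_part _ hw); rewrite -(inj_eq val_inj) /= in nk.
  by rewrite (negbTE nk).
rewrite big1 // => k _; rewrite (homog_part _ hw) (homog_part _ he).
case: eqP => // ki; case: eqP => // kj; case: nij.
by rewrite -ki -kj subnKC // -ltnS.
Qed.

(* d (w ⊗ e) = dw ⊗ e + (-1) ^ |w| w ⊗ de *)
Let diff (w : P) (e : Q) : T := gdiff w ⊗' e + gsign 1 w ⊗' gdiff e.

Lemma gtens_diff_bil : tens_bilinear diff.
Proof.
split=> z c x y; rewrite /diff ?gdiff_linear ?gsign_linear /tensor'.
  by rewrite !tensorDl !tensorZl scalerDr addrACA.
by rewrite !tensorDr !tensorZr scalerDr addrACA.
Qed.

Definition gtens_diff : T -> T := tens_lift diff.

Lemma gtens_diff_linear : linear gtens_diff.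
Proof. exact: tens_liftP gtens_diff_bil. Qed.

Lemma gtens_diffE w e i : homog i w ->
  gtens_diff (w ⊗' e) = gdiff w ⊗' e + (-1) ^+ i *: (w ⊗' gdiff e).
Proof.
move=> hw; rewrite /gtens_diff (tens_liftE gtens_diff_bil) /diff.
by rewrite (gsign_homog _ hw) mul1n /tensor' tensorZl.
Qed.

Lemma gtens_part_part n k x :
  gtens_part n (gtens_part k x) = if n == k then gtens_part k x else 0.
Proof.
have l0 i := linear_zero (gtens_part_linear i).
have lD i := linear_add (gtens_part_linear i).
elim/gtens_ind: x => [|x y hx hy|i j a b ha hb].
- by rewrite !l0 if_same.
- by rewrite !lD hx hy; case: eqP; rewrite ?addr0.
rewrite (gtens_partE _ ha hb); case: (k =P _) => [->|_]; last by rewrite l0 if_same.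
by rewrite (gtens_partE _ ha hb).
Qed.

Lemma gtens_part_sum x : exists N, x = \sum_(n < N) gtens_part n x.
Proof.
have l0 i := linear_zero (gtens_part_linear i).
have lD i := linear_add (gtens_part_linear i).
suff [N /(_ N (leqnn N))] :
    exists N, forall M, (N <= M)%N -> x = \sum_(n < M) gtens_part n x.
  by exists N.
elim/gtens_ind: x => [|x y [N hN] [M hM]|i j a b ha hb].
- by exists 0%N => M _; rewrite big1.
- exists (maxn N M) => L; rewrite geq_max => /andP[NL ML].
  rewrite [x in LHS](hN L) // [y in LHS](hM L) // -big_split.
  by apply: eq_bigr => n _; rewrite lD.
exists (i + j).+1 => M hM; rewrite (bigD1 (Ordinal hM)) //= big1 ?addr0.
  by rewrite (gtens_partE _ ha hb) eqxx.
move=> n; rewrite -(inj_eq val_inj) /= => /negbTE nij.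
by rewrite (gtens_partE _ ha hb) nij.
Qed.

Lemma gtens_part1 : gtens_part 0 1 = 1.
Proof. exact: gtens_partE (homog1 _) (homog1 _). Qed.

Let Dl := @mulrDl T : left_distributive *%R +%R.
Let Dr := @mulrDr T : right_distributive *%R +%R.

Lemma gtens_partM n k (x y : T) :
  gtens_part (n + k)%N (gtens_part n x * gtens_part k y) =
  gtens_part n x * gtens_part k y.
Proof.
have l0 i := linear_zero (gtens_part_linear i).
have lD i := linear_add (gtens_part_linear i).
have lZ i := linear_scale (gtens_part_linear i).
elim/gtens_ind: x => [|x x' hx hx'|i j a b ha hb].
- by rewrite !(l0, mul0r).
- by rewrite lD Dl lD hx hx'.
elim/gtens_ind: y => [|y y' hy hy'|i' j' a' b' ha' hb'].
- by rewrite !(l0, mulr0).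
- by rewrite lD Dr lD hy hy'.
rewrite (gtens_partE _ ha hb) (gtens_partE _ ha' hb').
case: eqP => [->|_]; last by rewrite mul0r l0.
case: eqP => [->|_]; last by rewrite mulr0 l0.
rewrite [_ * _](gtens_mulE _ _ hb ha') lZ.
by rewrite (gtens_partE _ (homogM ha ha') (homogM hb hb')) addnACA eqxx.
Qed.

Lemma gtens_diff_part n x :
  gtens_part n.+1 (gtens_diff (gtens_part n x)) = gtens_diff (gtens_part n x).
Proof.
have l0 i := linear_zero (gtens_part_linear i).
have lD i := linear_add (gtens_part_linear i).
have lZ i := linear_scale (gtens_part_linear i).
have d0 := linear_zero gtens_diff_linear.
have dD := linear_add gtens_diff_linear.
elim/gtens_ind: x => [|x y hx hy|i j a b ha hb].
- by rewrite !(l0, d0).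
- by rewrite !(lD, dD) hx hy.
rewrite (gtens_partE _ ha hb); case: eqP => [->|_]; last by rewrite !(l0, d0).
rewrite (gtens_diffE _ ha) lD lZ (gtens_partE _ (homog_diff ha) hb).
by rewrite (gtens_partE _ ha (homog_diff hb)) addSn addnS eqxx.
Qed.

Lemma gtens_diffK x : gtens_diff (gtens_diff x) = 0.
Proof.
have d0 := linear_zero gtens_diff_linear.
have dD := linear_add gtens_diff_linear.
have dZ := linear_scale gtens_diff_linear.
elim/gtens_ind: x => [|x y hx hy|i j a b ha hb].
- by rewrite !d0.
- by rewrite !dD hx hy addr0.
rewrite (gtens_diffE _ ha) dD dZ (gtens_diffE _ (homog_diff ha)) (gtens_diffE _ ha).
have z0l z : 0 ⊗' z = 0 by apply: linear_zero ((tensor_bilinear _ _).1 z).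
have z0r z : z ⊗' 0 = 0 by apply: linear_zero ((tensor_bilinear _ _).2 z).
by rewrite !gdiffK z0l z0r scaler0 addr0 add0r exprS mulN1r scaleNr addNr.
Qed.

Lemma gtens_diffM n (x y : T) : gtens_diff (gtens_part n x * y) =
  gtens_diff (gtens_part n x) * y + (-1) ^+ n *: (gtens_part n x * gtens_diff y).
Proof.
have l0 i := linear_zero (gtens_part_linear i).
have lD i := linear_add (gtens_part_linear i).
have d0 := linear_zero gtens_diff_linear.
have dD := linear_add gtens_diff_linear.
have dZ := linear_scale gtens_diff_linear.
elim/gtens_ind: x => [|x x' hx hx'|i j a b ha hb].
- by rewrite !(l0, d0, mul0r) scaler0 addr0.
- by rewrite !(lD, Dl, dD) hx hx' scalerDr addrACA.
elim/gtens_ind: y => [|y y' hy hy'|i' j' a' b' ha' hb'].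
- by rewrite !(mulr0, d0) scaler0 addr0.
- by rewrite !(Dr, dD) hy hy' scalerDr addrACA.
rewrite (gtens_partE _ ha hb).
case: eqP => [->|_]; last by rewrite !(d0, mul0r) scaler0 addr0.
have Tl z : {morph (fun x => x ⊗' z) : x y / x + y} by move=> *; apply: tensorDl.
have Tr z : {morph tensor' z : x y / x + y} by move=> *; apply: tensorDr.
have Zl c w z : (c *: w) ⊗' z = c *: (w ⊗' z) by apply: tensorZl.
have Zr c w z : w ⊗' (c *: z) = c *: (w ⊗' z) by apply: tensorZr.
rewrite [_ * _](gtens_mulE _ _ hb ha') dZ (gtens_diffE _ (homogM ha ha')).
rewrite (homog_diffM _ ha) (homog_diffM _ hb) Tl Tr Zl Zr.
rewrite (gtens_diffE _ ha) (gtens_diffE _ ha') Dl Dr -scalerAl -scalerAr.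
rewrite [(gdiff a ⊗' b) * _](gtens_mulE _ _ hb ha').
rewrite [(a ⊗' gdiff b) * _](gtens_mulE _ _ (homog_diff hb) ha').
rewrite [(a ⊗' b) * _](gtens_mulE _ _ hb (homog_diff ha')).
rewrite [(a ⊗' b) * _](gtens_mulE _ _ hb ha').
rewrite !scalerDr !scalerA -!exprD -!addrA; congr (_ + _).
have sgn k l : odd k = odd l -> (-1) ^+ k = (-1) ^+ l :> K.
  by move=> h; rewrite -signr_odd h signr_odd.
rewrite addrCA; congr (_ *: _ + (_ *: _ + _ *: _)).
- apply: sgn; rewrite !(oddD, oddM) /=.
  by case: (odd i) (odd i') (odd j) => -[] [].
- apply: sgn; rewrite !(oddD, oddM) /=.
  by case: (odd i) (odd i') (odd j) => -[] [].
- apply: sgn; rewrite !(oddD, oddM) /=.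
  by case: (odd i) (odd i') (odd j) => -[] [].
Qed.

HB.instance Definition _ := isDGAlgebra.Build K T
  gtens_part_linear gtens_part_part gtens_part_sum gtens_part1 gtens_partM
  gtens_diff_linear gtens_diff_part gtens_diffK gtens_diffM.

Lemma gtensM (w w' : P) (e e' : Q) i j : homog i e -> homog j w' ->
  (w ⊗ e : T) * (w' ⊗ e' : T) = (-1) ^+ (i * j) *: ((w * w') ⊗ (e * e') : T).
Proof. exact: gtens_mulE. Qed.

Lemma gtens_gdiff (w : P) (e : Q) i : homog i w ->
  gdiff (w ⊗ e : T) = (gdiff w ⊗ e : T) + (-1) ^+ i *: (w ⊗ gdiff e : T).
Proof. exact: gtens_diffE. Qed.

Lemma gtens_homog (w : P) (e : Q) i j : homog i w -> homog j e ->
  homog (i + j)%N (w ⊗ e : T).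
Proof. by move=> hw he; rewrite /homog [LHS](gtens_partE _ hw he) eqxx. Qed.

End GradedTensor.

Section Calculi.
Variable K : fieldType.

Record dg_morphism (Om Om' : dgAlgType K) (f : {lrmorphism Om -> Om'}) : Prop := {
  dg_morphism_homog : forall n w, homog n w -> homog n (f w);
  dg_morphism_diff : forall w, f (gdiff w) = gdiff (f w)
}.

(* The identification of A with Om^0 is an explicit embedding iota. *)
Record diff_calculus (A : algType K) (Om : dgAlgType K)
    (iota : {lrmorphism A -> Om}) : Prop := {
  diff_calculus_inj : injective iota;
  diff_calculus_deg0 : forall w, homog 0 w <-> exists a, w = iota a;
  diff_calculus_span : forall k w, homog k w <->
    exists s : seq (A * k.-tuple A),
      w = \sum_(p <- s) iota p.1 * \prod_(a <- p.2) gdiff (iota a)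
}.

Record hopf_algebra (H : algType K) := HopfAlgebra {
  comul : {lrmorphism H -> H ⊗ H};
  counit : {lrmorphism H -> K^o};
  antipode : {linear H -> H};
  comulA : forall h,
    tens_assoc (tens_map comul idfun (comul h)) = tens_map idfun comul (comul h);
  counitl : forall h, tens_lift (fun x y => counit x *: y) (comul h) = h;
  counitr : forall h, tens_lift (fun x y => counit y *: x) (comul h) = h;
  antipodel : forall h,
    tens_lift (fun x y => antipode x * y) (comul h) = counit h *: 1;
  antipoder : forall h,
    tens_lift (fun x y => x * antipode y) (comul h) = counit h *: 1
}.

Record right_comodule_algebra (H : algType K) (hopf : hopf_algebra H)
    (A : algType K) (Delta : {lrmorphism A -> A ⊗ H}) : Prop := {
  coactA : forall a,
    tens_assoc (tens_map Delta idfun (Delta a)) =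
    tens_map idfun (comul hopf) (Delta a);
  coact1 : forall a, tens_lift (fun x h => counit hopf h *: x) (Delta a) = a
}.

Definition complete_calculus (A H : algType K) (Delta : {lrmorphism A -> A ⊗ H})
    (OmA : dgAlgType K) (iotaA : {lrmorphism A -> OmA})
    (OmH : dgAlgType K) (iotaH : {lrmorphism H -> OmH}) : Prop :=
  exists Phi : {lrmorphism OmA -> gtens OmA OmH},
    dg_morphism Phi /\ forall a, Phi (iotaA a) = tens_map iotaA iotaH (Delta a).

(* The presentation of C[t, t^-1] by generators t, t' = t^-1 is expressed by   *)
(* its universal property.                                                    *)
Record laurent_algebra (H : algType K) (t t' : H) : Prop := {
  laurent_rel : t * t' = 1 /\ t' * t = 1;
  laurent_univ : forall (B : algType K) (x x' : B), x * x' = 1 -> x' * x = 1 ->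
    exists f : {lrmorphism H -> B}, [/\ f t = x, f t' = x' &
      forall g : {lrmorphism H -> B}, g t = x -> g t' = x' -> g =1 f]
}.

Record laurent_calculus (H : algType K) (t t' : H) (Om : dgAlgType K)
    (iota : {lrmorphism H -> Om}) : Prop := {
  laurent_is_calculus : diff_calculus iota;
  laurent_free1 : forall w : Om, homog 1 w <->
    exists! h : H, w = iota h * gdiff (iota t);
  laurent_comm : iota t * gdiff (iota t) = gdiff (iota t) * iota t;
  laurent_comm' : iota t' * gdiff (iota t) = gdiff (iota t) * iota t';
  laurent_top : forall k (w : Om), (2 <= k)%N -> homog k w -> w = 0
}.

End Calculi.

Section NCTorus.
Variable R : realType.
Local Notation C := R[i].

(* e ^ (i x) *)
Definition expi (x : R) : C := (cos x +i* sin x)%C.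

Definition nctorus_rel (theta : R) (A : algType C) (u u' v v' : A) : Prop :=
  [/\ u * u' = 1, u' * u = 1, v * v' = 1, v' * v = 1 &
      v * u = expi theta *: (u * v)].

(* Presentation by generators u, u' = u^-1, v, v' = v^-1 and the relations     *)
(* nctorus_rel, expressed by its universal property.                          *)
Record nctorus (theta : R) (A : algType C) (u u' v v' : A) : Prop := {
  nctorus_relP : nctorus_rel theta u u' v v';
  nctorus_univ : forall (B : algType C) (x x' y y' : B),
    nctorus_rel theta x x' y y' ->
    exists f : {lrmorphism A -> B},
      [/\ f u = x, f u' = x', f v = y & f v' = y'] /\
      forall g : {lrmorphism A -> B},
        g u = x -> g u' = x' -> g v = y -> g v' = y' -> g =1 f
}.

Record nctorus_calculus (theta : R) (A : algType C) (u v : A)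
    (Om : dgAlgType C) (iota : {lrmorphism A -> Om}) : Prop := {
  nctorus_is_calculus : diff_calculus iota;
  nctorus_free1 : forall w : Om, homog 1 w <->
    exists! ab : A * A,
      w = iota ab.1 * gdiff (iota u) + iota ab.2 * gdiff (iota v);
  nctorus_duu : gdiff (iota u) * iota u = iota u * gdiff (iota u);
  nctorus_dvv : gdiff (iota v) * iota v = iota v * gdiff (iota v);
  nctorus_duv :
    gdiff (iota u) * iota v = expi (- theta) *: (iota v * gdiff (iota u));
  nctorus_dvu :
    gdiff (iota v) * iota u = expi theta *: (iota u * gdiff (iota v));
  nctorus_free2 : forall w : Om, homog 2 w <->
    exists! a : A, w = iota a * (gdiff (iota u) * gdiff (iota v));
  nctorus_dudv : gdiff (iota u) * gdiff (iota v)
    + expi (- theta) *: (gdiff (iota v) * gdiff (iota u)) = 0;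
  nctorus_dudu : gdiff (iota u) * gdiff (iota u) = 0;
  nctorus_dvdv : gdiff (iota v) * gdiff (iota v) = 0;
  nctorus_top : forall k (w : Om), (3 <= k)%N -> homog k w -> w = 0
}.

End NCTorus.

(* Main.v *)
Require Import Defs.
From HB Require Import structures.
From mathcomp Require Import all_boot all_order all_algebra.
From mathcomp Require Import complex.
From mathcomp Require Import boolp classical_sets reals trigo.

Set Implicit Arguments.
Unset Strict Implicit.
Unset Printing Implicit Defensive.

Import GRing.Theory.
Local Open Scope ring_scope.

(** The calculus Om(A) is universal among the differential graded algebras that
    receive A in degree 0 and satisfy its commutation relations; through Delta
    the tensor product Om(A) ⊗ Om(H) is one of them.

    Write j : A -> Om for an algebra map into the degree 0 part of a
    differential graded algebra, du = d(j u), dv = d(j v), and suppose that du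
    and dv satisfy the four commutation relations with j u and j v
    ([torus_forms]). Differentiating these relations yields those between
    two-forms ([one_forms_anticommute]). Since A is generated by u, v and their
    inverses, du and dv commute past every j a up to a fixed rescaling
    automorphism of A ([du_commute], [dv_commute]), and d(j a) = j b du + j c dv
    with b, c depending on a alone ([diff_coefficients]). Hence the elements
      j a + j b du + j c dv + j e du dv
    are multiplied and differentiated by formulas in a, b, c, e that do not
    depend on j ([normal_formM], [normal_form_diff]). If every element of Om(A)
    has exactly one such normal form, reading off its coefficients and
    evaluating them in Om is therefore a morphism of differential graded
    algebras that extends j ([free_torus_calculus_universal]).

    It remains to take j a = Delta a, viewed in Om(A) ⊗ Om(H). The images of the
    generators are u ⊗ t and v ⊗ t^-1; as t, t^-1 and their differentials
    commute, the relations of du and dv pass to d(u ⊗ t) and d(v ⊗ t^-1)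
    ([torus_forms_tensor]). *)

(** * Subalgebras cut out by a predicate *)

Lemma lrmorphism_intro (K : fieldType) (A B : algType K) (f : A -> B) :
  linear f -> f 1 = 1 -> {morph f : x y / x * y} ->
  exists g : {lrmorphism A -> B}, g =1 f.
Proof.
move=> flin f1 fM.
pose fl := GRing.isLinear.Build K A B *:%R f flin.
pose fm := GRing.isMonoidMorphism.Build A B f (conj f1 fM).
pose g : {lrmorphism A -> B} := HB.pack f fl fm.
by exists g.
Qed.

Section Subalgebra.
Variables (K : fieldType) (A : algType K) (P : A -> Prop).
Hypotheses (P1 : P 1) (Plin : forall c x y, P x -> P y -> P (c *: x + y))
  (PM : forall x y, P x -> P y -> P (x * y)).

Definition subalg_pred : {pred A} := fun a => `[< P a >].

Lemma subalg_pred_closed : GRing.subalg_closed subalg_pred.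
Proof.
split; first exact/asboolP.
  by move=> c x y /asboolP Px /asboolP Py; apply/asboolP/Plin.
by move=> x y /asboolP Px /asboolP Py; apply/asboolP/PM.
Qed.

HB.instance Definition _ :=
  GRing.isSubalgClosed.Build K A subalg_pred subalg_pred_closed.

Definition subalg : Type := {a : A | a \in subalg_pred}.
HB.instance Definition _ := Choice.on subalg.
HB.instance Definition _ := SubType.on subalg.
HB.instance Definition _ := [SubChoice_isSubAlgebra of subalg by <:].

(** Packaged existentially, so that an induction principle for generators can use
    the subalgebra as a test object of a universal property. *)
Lemma subalg_intro : exists (B : algType K) (i : {lrmorphism B -> A}),
  [/\ injective i, forall b, P (i b) & forall a, P a -> exists b, i b = a].
Proof.
have [i iE] : exists i : {lrmorphism subalg -> A}, i =1 val.
  exact: lrmorphism_intro.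
exists subalg, i; split=> [b b'|b|a Pa].
- by rewrite !iE; apply: val_inj.
- by rewrite iE; apply/asboolP/(valP b).
by exists (Sub a (introT (asboolP (P a)) Pa)); rewrite iE SubK.
Qed.

End Subalgebra.

(** * Calculus with forms of low degree *)

Section DGA.
Variables (K : fieldType) (Om : dgAlgType K).

Lemma gdiff_homog0M (w w' : Om) : homog 0 w ->
  gdiff (w * w') = gdiff w * w' + w * gdiff w'.
Proof. by move=> w0; rewrite (homog_diffM _ w0) expr0 scale1r. Qed.

Lemma gdiff_homog1M (w w' : Om) : homog 1 w ->
  gdiff (w * w') = gdiff w * w' - w * gdiff w'.
Proof. by move=> w1; rewrite (homog_diffM _ w1) expr1 scaleN1r. Qed.

Lemma gdiff1 : gdiff (1 : Om) = 0.
Proof.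
have /(gdiff_homog0M 1) : homog 0 (1 : Om) by apply: gpart1.
by rewrite !mulr1 mul1r => /eqP; rewrite -subr_eq0 opprD addNKr oppr_eq0 => /eqP.
Qed.

(** This is d of the hypothesis: d(dx y) = - dx dy and d(y dx) = dy dx. *)
Lemma one_forms_anticommute (x y : Om) (c : K) :
  homog 0 x -> homog 0 y -> gdiff x * y = c *: (y * gdiff x) ->
  gdiff x * gdiff y = - c *: (gdiff y * gdiff x).
Proof.
move=> x0 y0 /(congr1 gdiff); rewrite (linear_scale (@gdiff_linear _ _)).
rewrite (gdiff_homog1M _ (homog_diff x0)) (gdiff_homog0M _ y0) gdiffK.
by rewrite mul0r add0r mulr0 addr0 scaleNr => <-; rewrite opprK.
Qed.

(** From 0 = d(x' x) = dx' x + x' dx. *)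
Lemma gdiff_inv (x x' : Om) : homog 0 x' -> x * x' = 1 -> x' * x = 1 ->
  gdiff x' = - (x' * (gdiff x * x')).
Proof.
move=> x'0 xx' x'x; have /(congr1 (fun w => gdiff w * x')) := x'x.
rewrite (gdiff_homog0M _ x'0) gdiff1 mul0r mulrDl -!mulrA xx' mulr1 => /eqP.
by rewrite addr_eq0 => /eqP.
Qed.

End DGA.

(** * Tensor products of differential graded algebras *)

Lemma tens_map_bil (K : fieldType) (V W V' W' : lmodType K)
    (f : {linear V -> V'}) (g : {linear W -> W'}) :
  tens_bilinear (fun x y => f x ⊗ g y).
Proof.
by split=> z c x y; rewrite /= linearP ?tensorDl ?tensorDr ?tensorZl ?tensorZr.
Qed.

Lemma tens_mapE (K : fieldType) (V W V' W' : lmodType K)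
    (f : {linear V -> V'}) (g : {linear W -> W'}) x y :
  tens_map f g (x ⊗ y) = f x ⊗ g y.
Proof. exact: tens_liftE (tens_map_bil f g) _ _. Qed.

Section TensorDGA.
Variables (K : fieldType) (P Q : dgAlgType K).
Local Notation T := (gtens P Q).

(** The source carries the unsigned product of A ⊗ B and the target the graded
    one; they agree here because the sign is trivial in degree 0. *)
Lemma tens_map_lrmorphism (A B : algType K) (f : {lrmorphism A -> P})
    (g : {lrmorphism B -> Q}) :
  (forall a, homog 0 (f a)) -> (forall b, homog 0 (g b)) ->
  exists D : {lrmorphism A ⊗ B -> T},
    (forall x, D x = tens_map f g x) /\ forall x, homog 0 (D x).
Proof.
move=> f0 g0.
have DE a b : tens_map f g (a ⊗ b) = f a ⊗ g b by apply: tens_mapE.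
pose D : A ⊗ B -> T := tens_map f g.
have Dlin : linear D by apply: (tens_liftP (tens_map_bil f g)).
have D0 := linear_zero Dlin; have DD := linear_add Dlin.
have DM : {morph D : x y / x * y}.
  move=> x y; elim/tens_ind: x => [|x x' hx hx'|a b].
  - by rewrite mul0r !D0 mul0r.
  - by rewrite mulrDl !DD hx hx' mulrDl.
  elim/tens_ind: y => [|y y' hy hy'|a' b'].
  - by rewrite mulr0 !D0 mulr0.
  - by rewrite mulrDr !DD hy hy' mulrDr.
  rewrite tensorM /D !DE !rmorphM.
  by rewrite (gtensM _ _ (g0 b) (f0 a')) expr0 scale1r.
have D1 : D 1 = 1 by rewrite /D DE !rmorph1.
have [Phi PhiE] := lrmorphism_intro Dlin D1 DM.
exists Phi; split=> [x|x]; rewrite PhiE // /homog.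
have gD := linear_add (@gpart_linear _ T 0).
elim/tens_ind: x => [|x y hx hy|a b].
- by rewrite D0 (linear_zero (@gpart_linear _ T 0)).
- by rewrite DD gD hx hy.
by rewrite /D DE; apply: gtens_homog (f0 a) (g0 b).
Qed.

(** By the Leibniz rule d(x ⊗ s) = dx ⊗ s + x ⊗ ds, and y ⊗ r commutes past both
    summands with the factor c; no sign appears since y and r have degree 0. *)
Lemma tensor_forms_commute (x y : P) (s r : Q) (c : K) :
  homog 0 x -> homog 0 y -> homog 0 s -> homog 0 r ->
  x * y = c *: (y * x) -> gdiff x * y = c *: (y * gdiff x) ->
  s * r = r * s -> gdiff s * r = r * gdiff s ->
  gdiff (x ⊗ s : T) * (y ⊗ r : T) = c *: ((y ⊗ r : T) * gdiff (x ⊗ s : T)).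
Proof.
move=> x0 y0 s0 r0 xy dxy sr dsr.
rewrite (gtens_gdiff _ x0) expr0 scale1r mulrDl mulrDr.
rewrite (gtensM _ _ s0 y0) (gtensM _ _ (homog_diff s0) y0).
rewrite (gtensM _ _ r0 (homog_diff x0)) (gtensM _ _ r0 x0).
rewrite !mul0n muln0 expr0 !scale1r xy dxy sr dsr.
by rewrite !tensorZl scalerDr.
Qed.

End TensorDGA.

(** * The quantum torus over a field *)

Definition qtorus_rel (K : fieldType) (q : K) (A : algType K) (u u' v v' : A) :=
  [/\ u * u' = 1, u' * u = 1, v * v' = 1, v' * v = 1 & v * u = q *: (u * v)].

(** The universal property of the noncommutative torus, with the unit complex
    number e^(i theta) replaced by a scalar q of an arbitrary field. *)
Record qtorus (K : fieldType) (q : K) (A : algType K) (u u' v v' : A) : Prop := {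
  qtorus_relP : qtorus_rel q u u' v v';
  qtorus_univ : forall (B : algType K) (x x' y y' : B),
    qtorus_rel q x x' y y' ->
    exists f : {lrmorphism A -> B},
      [/\ f u = x, f u' = x', f v = y & f v' = y'] /\
      forall g : {lrmorphism A -> B},
        g u = x -> g u' = x' -> g v = y -> g v' = y' -> g =1 f
}.

Section Torus.
Variables (K : numFieldType) (q : K).
Hypothesis q0 : q != 0.
Variables (A : algType K) (u u' v v' : A).
Hypothesis torusA : qtorus q u u' v v'.

(** Let B be the subalgebra defined by P, i : B -> A its inclusion. The universal
    property gives f : A -> B with i f = id on the generators, hence i f = id. *)
Lemma qtorus_ind (P : A -> Prop) :
  P 1 -> (forall c x y, P x -> P y -> P (c *: x + y)) ->
  (forall x y, P x -> P y -> P (x * y)) ->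
  P u -> P u' -> P v -> P v' -> forall a, P a.
Proof.
move=> P1 Plin PM Pu Pu' Pv Pv' a.
have [B [i [iinj iP iS]]] := subalg_intro P1 Plin PM.
have [[x xu] [x' xu'] [y yv] [y' yv']] : [/\ exists b, i b = u,
  exists b, i b = u', exists b, i b = v & exists b, i b = v'].
  by split; apply: iS.
have [uu' u'u vv' v'v vu] := qtorus_relP torusA.
have [|f [[fu fu' fv fv'] _]] :=
    @qtorus_univ _ _ _ _ _ _ _ torusA B x x' y y'.
  by split; apply: iinj;
    rewrite ?linearZ !rmorphM ?rmorph1 /= ?xu ?xu' ?yv ?yv'.
have [g [_ guniq]] := qtorus_univ torusA (qtorus_relP torusA).
have /= ifE : i \o f =1 g by apply: guniq; rewrite /= (fu, fu', fv, fv').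
have gE : idfun =1 g by apply: guniq.
by rewrite -[a]/(idfun a) gE -ifE; apply: iP.
Qed.

(** The relation v u = q u v is homogeneous in u and in v. *)
Lemma rescaling (a b : K) : a != 0 -> b != 0 ->
  exists s : {lrmorphism A -> A}, s u = a *: u /\ s v = b *: v.
Proof.
move=> a0 b0; have [uu' u'u vv' v'v vu] := qtorus_relP torusA.
have [|s [[su _ sv _] _]] := @qtorus_univ _ _ _ _ _ _ _ torusA A
    (a *: u) (a^-1 *: u') (b *: v) (b^-1 *: v').
  split; rewrite -scalerAl -scalerAr scalerA ?uu' ?u'u ?vv' ?v'v.
  - by rewrite divff ?scale1r.
  - by rewrite mulVf ?scale1r.
  - by rewrite divff ?scale1r.
  - by rewrite mulVf ?scale1r.
  - by rewrite -scalerAl -scalerAr vu !scalerA mulrC [b * a]mulrC -mulrA.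
by exists s.
Qed.

(** j (s x') w = j (s x') w (j x) (j x') = j (s x') j (s x) w (j x') = w (j x'). *)
Lemma twisted_commute_inv (B : algType K) (j : {lrmorphism A -> B})
    (s : {lrmorphism A -> A}) (w : B) (x x' : A) : x * x' = 1 -> x' * x = 1 ->
  w * j x = j (s x) * w -> w * j x' = j (s x') * w.
Proof.
move=> xx' x'x wx; rewrite -[w in LHS]mul1r -(rmorph1 j) -(rmorph1 s) -x'x.
by rewrite !rmorphM -!mulrA [j (s x) * _]mulrA -wx -mulrA -rmorphM xx' rmorph1 mulr1.
Qed.

Lemma twisted_commute (B : algType K) (j : {lrmorphism A -> B})
    (s : {lrmorphism A -> A}) (w : B) :
  w * j u = j (s u) * w -> w * j v = j (s v) * w ->
  forall a, w * j a = j (s a) * w.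
Proof.
have [uu' u'u vv' v'v vu] := qtorus_relP torusA.
move=> wu wv; apply: qtorus_ind => //.
- by rewrite !rmorph1 mulr1 mul1r.
- by move=> c x y hx hy; rewrite !linearP mulrDr mulrDl -scalerAr -scalerAl hx hy.
- by move=> x y hx hy; rewrite !rmorphM mulrA hx -mulrA hy mulrA.
- exact: twisted_commute_inv wu.
- exact: twisted_commute_inv wv.
Qed.

(** * Normal forms of differential forms on the torus *)

(** Only relations of one-forms with functions are listed: those between two
    one-forms follow by differentiation. *)
Record torus_forms (Om : dgAlgType K) (j : {lrmorphism A -> Om}) : Prop := {
  forms_deg0 : forall a, homog 0 (j a);
  forms_duu : gdiff (j u) * j u = j u * gdiff (j u);
  forms_dvv : gdiff (j v) * j v = j v * gdiff (j v);
  forms_duv : gdiff (j u) * j v = q^-1 *: (j v * gdiff (j u));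
  forms_dvu : gdiff (j v) * j u = q *: (j u * gdiff (j v))
}.

Definition normal_form (Om : dgAlgType K) (j : A -> Om) (x : A * A * A * A) : Om :=
  let: (a, b, c, e) := x in
  j a + j b * gdiff (j u) + j c * gdiff (j v)
    + j e * (gdiff (j u) * gdiff (j v)).

(** The automorphisms su and sv record how functions move past du and dv; they
    exist by [twists_exist]. *)
Section Twists.
Variables su sv : {lrmorphism A -> A}.
Hypotheses (suu : su u = u) (suv : su v = q^-1 *: v).
Hypotheses (svu : sv u = q *: u) (svv : sv v = v).

Section Forms.
Variables (Om : dgAlgType K) (j : {lrmorphism A -> Om}).
Hypothesis jP : torus_forms j.
Local Notation du := (gdiff (j u)).
Local Notation dv := (gdiff (j v)).

(** Here [one_forms_anticommute] gives dx dx = - dx dx, and K has characteristic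
    0. *)
Lemma one_form_square x : gdiff (j x) * j x = j x * gdiff (j x) ->
  gdiff (j x) * gdiff (j x) = 0.
Proof.
move=> xx; have x0 := forms_deg0 jP x.
have := one_forms_anticommute (c := 1) x0 x0; rewrite scale1r => /(_ xx) /eqP.
rewrite scaleN1r -subr_eq0 opprK -mulr2n -scaler_nat scaler_eq0.
by rewrite Num.Theory.pnatr_eq0 => /eqP.
Qed.

Lemma forms_dudu : du * du = 0.
Proof. exact/one_form_square/(forms_duu jP). Qed.

Lemma forms_dvdv : dv * dv = 0.
Proof. exact/one_form_square/(forms_dvv jP). Qed.

Lemma forms_dvdu : dv * du = - q *: (du * dv).
Proof.
exact: (one_forms_anticommute (forms_deg0 jP v) (forms_deg0 jP u) (forms_dvu jP)).
Qed.

Lemma normal_form_linear : linear (normal_form j).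
Proof.
move=> k [[[a b] c] e] [[[a' b'] c'] e'] /=.
rewrite !linearP !mulrDl -!scalerAl !scalerDr.
by rewrite [X in X + _ + _ = _]addrACA [X in X + _ = _]addrACA [LHS]addrACA.
Qed.

Lemma du_commute a : du * j a = j (su a) * du.
Proof.
apply: twisted_commute; first by rewrite suu (forms_duu jP).
by rewrite suv linearZ -scalerAl (forms_duv jP).
Qed.

Lemma dv_commute a : dv * j a = j (sv a) * dv.
Proof.
apply: twisted_commute; last by rewrite svv (forms_dvv jP).
by rewrite svu linearZ -scalerAl (forms_dvu jP).
Qed.

(** The product of two normal forms on coefficients: a function passes du through
    su and dv through sv, and the sign comes from dv du = - q du dv. *)
Definition form_mul (x y : A * A * A * A) : A * A * A * A :=
  let: (a, b, c, e) := x in let: (a', b', c', e') := y in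
  (a * a', a * b' + b * su a', a * c' + c * sv a',
   a * e' + b * su c' - q *: (c * sv b') + e * su (sv a')).

(** The formula for the coefficients is the same for every j, which is what makes
    the comparison of two calculi multiplicative. *)
Lemma normal_formM x y :
  normal_form j x * normal_form j y = normal_form j (form_mul x y).
Proof.
have duj a w : du * (j a * w) = j (su a) * (du * w).
  by rewrite mulrA du_commute mulrA.
have dvj a w : dv * (j a * w) = j (sv a) * (dv * w).
  by rewrite mulrA dv_commute mulrA.
have duu w : du * (du * w) = 0 by rewrite mulrA forms_dudu mul0r.
have dvv w : dv * (dv * w) = 0 by rewrite mulrA forms_dvdv mul0r.
have dvu w : dv * (du * w) = - q *: (du * (dv * w)).
  by rewrite mulrA forms_dvdu -scalerAl mulrA.
case: x y => [[[a b] c] e] [[[a' b'] c'] e'] /=.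
rewrite !(rmorphD, rmorphN, rmorphM) /= [j (q *: _)]linearZ /= rmorphM /=.
rewrite !(mulrDl, mulrDr, mulNr) -!mulrA.
rewrite !(duj, dvj, du_commute, dv_commute).
rewrite !(duu, dvv, dvu, forms_dudu, forms_dvdv, forms_dvdu).
rewrite -!scalerAr -!scalerAl duu ?(scaler0, mulr0, addr0, add0r) -?mulrA ?scaleNr.
(* The nine surviving terms, regrouped by the form 1, du, dv or du dv they
   multiply. *)
by rewrite [LHS](AC (4*2*2*1) (1*(2*5)*(3*7)*(4*6*8*9))).
Qed.

End Forms.

(** The quantifier order matters: b and c are chosen before Om and j, so that d is
    given by the same coefficients in every calculus. The property is stable
    under products by the Leibniz rule and [du_commute], [dv_commute], and
    holds for inverses by [gdiff_inv]. *)
Lemma diff_coefficients a : exists b c, forall (Om : dgAlgType K)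
    (j : {lrmorphism A -> Om}), torus_forms j ->
  gdiff (j a) = j b * gdiff (j u) + j c * gdiff (j v).
Proof.
have [uu' u'u vv' v'v vu] := qtorus_relP torusA.
have diff_inv (x x' : A) : x * x' = 1 -> x' * x = 1 ->
    forall (Om : dgAlgType K) (j : {lrmorphism A -> Om}), torus_forms j ->
    gdiff (j x') = - (j x' * (gdiff (j x) * j x')).
  move=> xx' x'x Om j jP; apply: gdiff_inv; rewrite -?rmorphM ?xx' ?x'x ?rmorph1 //.
  exact: forms_deg0.
move: a; apply: qtorus_ind.
- by exists 0, 0 => Om j jP; rewrite rmorph1 gdiff1 !rmorph0 !mul0r addr0.
- move=> k x y [b [c h]] [b' [c' h']]; exists (k *: b + b'), (k *: c + c').
  move=> Om j jP; rewrite linearP gdiff_linear (h _ _ jP) (h' _ _ jP) !linearP /=.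
  by rewrite !mulrDl scalerDr -!scalerAl addrACA.
- move=> x y [b [c h]] [b' [c' h']].
  exists (b * su y + x * b'), (c * sv y + x * c') => Om j jP.
  rewrite rmorphM (gdiff_homog0M _ (forms_deg0 jP _)) (h _ _ jP) (h' _ _ jP).
  rewrite !mulrDl -!mulrA (du_commute jP) (dv_commute jP) mulrDr.
  by rewrite !(rmorphD, rmorphM) /= !mulrDl addrACA !mulrA.
- by exists 1, 0 => Om j jP; rewrite rmorph1 rmorph0 mul1r mul0r addr0.
- exists (- (u' * su u')), 0 => Om j jP; rewrite (diff_inv _ _ uu' u'u _ _ jP).
  by rewrite (du_commute jP) rmorph0 mul0r addr0 !(rmorphN, rmorphM) mulNr mulrA.
- by exists 0, 1 => Om j jP; rewrite rmorph1 rmorph0 mul1r mul0r add0r.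
- exists 0, (- (v' * sv v')) => Om j jP; rewrite (diff_inv _ _ vv' v'v _ _ jP).
  by rewrite (dv_commute jP) rmorph0 mul0r add0r !(rmorphN, rmorphM) mulNr mulrA.
Qed.

Lemma normal_form_diff x : exists y, forall (Om : dgAlgType K)
    (j : {lrmorphism A -> Om}), torus_forms j ->
  gdiff (normal_form j x) = normal_form j y.
Proof.
case: x => [[[a b] c] e].
have [a1 [a2 ha]] := diff_coefficients a.
have [b1 [b2 hb]] := diff_coefficients b.
have [c1 [c2 hc]] := diff_coefficients c.
have [e1 [e2 he]] := diff_coefficients e.
(* The du dv coefficient is a twisted curl of (b, c): the part b2 dv of db meets du on
   its right, and dv du = - q du dv. *)
exists (0, a1, a2, - (q *: b2) + c1) => Om j jP /=.
set du := gdiff (j u); set dv := gdiff (j v).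
have dD := linear_add (@gdiff_linear _ Om).
rewrite !dD !(gdiff_homog0M _ (forms_deg0 jP _)).
rewrite (gdiff_homog1M _ (homog_diff (forms_deg0 jP _))) !gdiffK.
rewrite (ha _ _ jP) (hb _ _ jP) (hc _ _ jP) (he _ _ jP).
rewrite !mulrDl -!mulrA (forms_dvdu jP) (forms_dudu jP) (forms_dvdv jP).
have -> : du * (du * dv) = 0 by rewrite mulrA (forms_dudu jP) mul0r.
have -> : dv * (du * dv) = 0.
  by rewrite mulrA (forms_dvdu jP) -scalerAl -mulrA (forms_dvdv jP) mulr0 scaler0.
rewrite mul0r !mulr0 subr0 mulr0 !addr0 rmorph0 add0r -addrA.
rewrite rmorphD rmorphN /= [j (q *: _)]linearZ /= mulrDl mulNr -scalerAl.
by rewrite -scalerAr scaleNr -!addrA add0r.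
Qed.

End Twists.

Lemma twists_exist : exists su sv : {lrmorphism A -> A},
  [/\ su u = u, su v = q^-1 *: v, sv u = q *: u & sv v = v].
Proof.
have [su [suu suv]] := rescaling (oner_neq0 K) (invr_neq0 q0).
have [sv [svu svv]] := rescaling q0 (oner_neq0 K).
by exists su, sv; rewrite suu suv svu svv !scale1r.
Qed.

Definition form_part (n : nat) (x : A * A * A * A) : A * A * A * A :=
  let: (a, b, c, e) := x in
  match n with
  | 0 => (a, 0, 0, 0)
  | 1 => (0, b, c, 0)
  | 2 => (0, 0, 0, e)
  | _ => 0
  end.

Lemma normal_form_part n x (Om : dgAlgType K) (j : {lrmorphism A -> Om}) :
  torus_forms j -> gpart n (normal_form j x) = normal_form j (form_part n x).
Proof.
move=> jP; case: x => [[[a b] c] e] /=.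
have gD := linear_add (@gpart_linear _ Om n).
have h0 z : homog 0 (j z) by apply: (forms_deg0 jP).
have h1 y z : homog 1 (j z * gdiff (j y)) := homogM (h0 z) (homog_diff (h0 y)).
have h2 y y' z : homog 2 (j z * (gdiff (j y) * gdiff (j y'))).
  exact: homogM (h0 z) (homogM (homog_diff (h0 y)) (homog_diff (h0 y'))).
rewrite !gD (homog_part _ (h0 a)) !(homog_part _ (h1 _ _)) (homog_part _ (h2 _ _ _)).
by case: n {gD} => [|[|[|n]]] /=; rewrite !rmorph0 !mul0r ?(addr0, add0r).
Qed.

(** * Universality of the free calculus *)

Section Extension.
Variables (Om0 : dgAlgType K) (iota : {lrmorphism A -> Om0}).
Hypothesis iotaP : torus_forms iota.
Hypothesis iota_free : forall w, exists! x, w = normal_form iota x.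

(** Phi sends a form to the normal form in Om with the same coefficients. Sums,
    products, differentials and homogeneous parts of normal forms have
    coefficients independent of the algebra, so Phi respects all of them;
    uniqueness of coefficients in Om0 lets any expression of w in normal form
    be used to compute Phi w. *)
Theorem free_torus_calculus_universal (Om : dgAlgType K)
    (j : {lrmorphism A -> Om}) : torus_forms j ->
  exists Phi : {lrmorphism Om0 -> Om},
    dg_morphism Phi /\ forall a, Phi (iota a) = j a.
Proof.
move=> jP; have [su [sv [suu suv svu svv]]] := twists_exist.
pose coords w := sval (cid (iota_free w)).
have coordsE w : w = normal_form iota (coords w) by rewrite /coords; case: cid => ? [].
have coordsK x w : w = normal_form iota x -> coords w = x.
  by move=> wE; rewrite /coords; case: cid => y [_ yu] /=; apply: yu.
pose phi w := normal_form j (coords w).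
have phiE x w : w = normal_form iota x -> phi w = normal_form j x.
  by rewrite /phi => /coordsK ->.
have phi_iota a : phi (iota a) = j a.
  rewrite (phiE (a, 0, 0, 0)) /=; last first.
    by rewrite rmorph0 !mul0r !addr0.
  by rewrite rmorph0 !mul0r !addr0.
have phi_lin : linear phi.
  move=> k w w'; rewrite (phiE (k *: coords w + coords w')).
    exact: normal_form_linear.
  by rewrite (normal_form_linear iota) -!coordsE.
have phi1 : phi 1 = 1 by rewrite -(rmorph1 iota) phi_iota rmorph1.
have phiM : {morph phi : w w' / w * w'}.
  move=> w w'; rewrite (phiE (form_mul su sv (coords w) (coords w'))).
    by rewrite -(normal_formM suu suv svu svv jP).
  by rewrite -(normal_formM suu suv svu svv iotaP) -!coordsE.
have [Phi PhiE] := lrmorphism_intro phi_lin phi1 phiM.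
exists Phi; split; last by move=> a; rewrite PhiE.
split=> [n w wn|w]; rewrite !PhiE.
  rewrite /homog [RHS](phiE (form_part n (coords w))).
    exact: normal_form_part.
  by rewrite -(normal_form_part _ _ iotaP) -coordsE.
have [y yE] := normal_form_diff suu suv svu svv (coords w).
by rewrite (phiE y) -yE // -coordsE.
Qed.

End Extension.

(** Each of the four relations is an instance of [tensor_forms_commute], whose
    factor c is 1 for u with u and v with v, and q^-1 or q for mixed pairs. *)
Lemma torus_forms_tensor (P Q : dgAlgType K) (iota : {lrmorphism A -> P})
    (s s' : Q) (j : {lrmorphism A -> gtens P Q}) :
  torus_forms iota -> homog 0 s -> homog 0 s' -> s * s' = s' * s ->
  {in [:: s; s'] &, forall x y, gdiff x * y = y * gdiff x} ->
  (forall a, homog 0 (j a)) -> j u = iota u ⊗ s -> j v = iota v ⊗ s' ->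
  torus_forms j.
Proof.
move=> iotaP s0 s'0 ss' ds j0 ju jv; have iota0 := forms_deg0 iotaP.
have [_ _ _ _ vu] := qtorus_relP torusA.
have iota_vu : iota v * iota u = q *: (iota u * iota v).
  by rewrite -!rmorphM vu /= linearZ.
have iota_uv : iota u * iota v = q^-1 *: (iota v * iota u).
  by rewrite iota_vu scalerA mulVf ?scale1r.
have sP : s \in [:: s; s'] by rewrite inE eqxx.
have s'P : s' \in [:: s; s'] by rewrite !inE eqxx orbT.
split=> //; rewrite ?ju ?jv.
- rewrite -[RHS]scale1r; apply: tensor_forms_commute; rewrite ?scale1r ?ds //.
  exact: forms_duu iotaP.
- rewrite -[RHS]scale1r; apply: tensor_forms_commute; rewrite ?scale1r ?ds //.
  exact: forms_dvv iotaP.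
- apply: tensor_forms_commute; rewrite ?ds //; exact: forms_duv iotaP.
- apply: tensor_forms_commute; rewrite ?ds //; exact: forms_dvu iotaP.
Qed.

End Torus.

(** * The two calculi *)

Lemma diff_calculus_iota0 (K : fieldType) (A : algType K) (Om : dgAlgType K)
    (iota : {lrmorphism A -> Om}) : diff_calculus iota ->
  forall a, homog 0 (iota a).
Proof. by move=> calc a; apply/(diff_calculus_deg0 calc); exists a. Qed.

Section NCTorus.
Variables (R : realType) (theta : R).
Local Notation C := R[i].

Lemma expi_mulN : expi (- theta) * expi theta = 1 :> C.
Proof.
rewrite /expi cosN sinN; apply/eqP; rewrite eq_complex /=.
rewrite mulNr opprK mulNr -!expr2 cos2Dsin2 [sin _ * _]mulrC subrr.
by rewrite !eqxx.
Qed.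

Lemma expi_neq0 : expi theta != 0 :> C.
Proof.
apply/eqP => e0; have := expi_mulN; rewrite e0 mulr0 => /eqP.
by rewrite eq_sym oner_eq0.
Qed.

Lemma expiN : expi (- theta) = (expi theta)^-1 :> C.
Proof. by rewrite -[RHS]mul1r -expi_mulN mulfK // expi_neq0. Qed.

Variables (A : algType C) (u v : A) (Om : dgAlgType C).
Variable iota : {lrmorphism A -> Om}.
Hypothesis calcA : nctorus_calculus theta u v iota.

Lemma nctorus_calculus_forms :
  torus_forms (K := C) (expi theta) u v iota.
Proof.
split.
- exact: diff_calculus_iota0 (nctorus_is_calculus calcA).
- exact: nctorus_duu calcA.
- exact: nctorus_dvv calcA.
- by rewrite -expiN; exact: nctorus_duv calcA.
- exact: nctorus_dvu calcA.
Qed.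

Lemma sum_low_parts (w : Om) : w = gpart 0 w + gpart 1 w + gpart 2 w.
Proof.
have lin_id (n : nat) : linear (fun x : Om => x) by [].
rewrite {1}[w]gboundE -/(gsum (fun _ x => x) w).
(* Adding three terms to the range makes parts 0, 1 and 2 available even when w
   has a smaller degree bound. *)
rewrite (gsum_wide lin_id (N := (gbound w).+3)); last by rewrite -addn3 leq_addr.
rewrite !big_ord_recl big1 /= ?addr0 ?addrA // => i _.
by apply: (nctorus_top calcA _ (gpart_homog _ _)).
Qed.

Lemma nctorus_calculus_free w :
  exists! x, w = normal_form (K := C) u v iota x.
Proof.
have F := nctorus_calculus_forms; have calc := nctorus_is_calculus calcA.
have [a wa] := (diff_calculus_deg0 calc _).1 (gpart_homog 0 w).
have [[b c] [/= wbc bc_uniq]] := (nctorus_free1 calcA _).1 (gpart_homog 1 w).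
have [e [we e_uniq]] := (nctorus_free2 calcA _).1 (gpart_homog 2 w).
exists (a, b, c, e); split.
  by rewrite /normal_form -wa -[_ + _ + iota c * _]addrA -wbc -we -sum_low_parts.
move=> [[[a' b'] c'] e'] wE.
have aE : a = a'.
  apply: (diff_calculus_inj calc); rewrite -wa wE (normal_form_part _ _ F) /=.
  by rewrite !rmorph0 !mul0r !addr0.
have bcE : (b, c) = (b', c').
  apply: bc_uniq; rewrite wE (normal_form_part _ _ F) /=.
  by rewrite !rmorph0 !mul0r addr0 add0r.
have -> : e = e'.
  apply: e_uniq; rewrite wE (normal_form_part _ _ F) /=.
  by rewrite !rmorph0 !mul0r !add0r.
by rewrite aE; case: bcE => -> ->.
Qed.

End NCTorus.

Section Laurent.
Variables (K : fieldType) (H : algType K) (t t' : H) (Om : dgAlgType K).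
Variable iota : {lrmorphism H -> Om}.
Hypotheses (laurentH : laurent_algebra t t') (calcH : laurent_calculus t t' iota).

(** For dt this is given; the case of t^-1 reduces to it because
    d(t^-1) = - t^-1 dt t^-1. *)
Lemma laurent_diff_commute :
  {in [:: iota t; iota t'] &, forall x y, gdiff x * y = y * gdiff x}.
Proof.
have [tt' t't] := laurent_rel laurentH.
have dt_comm y : y \in [:: iota t; iota t'] ->
    gdiff (iota t) * y = y * gdiff (iota t).
  rewrite !inE => /orP[] /eqP ->; first by rewrite (laurent_comm calcH).
  by rewrite (laurent_comm' calcH).
have t'_comm y : y \in [:: iota t; iota t'] -> iota t' * y = y * iota t'.
  by rewrite !inE => /orP[] /eqP -> //; rewrite -!rmorphM tt' t't.
move=> x y + yP; rewrite !inE => /orP[] /eqP ->; first exact: dt_comm.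
have -> : gdiff (iota t') = - (iota t' * (gdiff (iota t) * iota t')).
  apply: gdiff_inv; rewrite -?rmorphM ?tt' ?t't ?rmorph1 //.
  exact: diff_calculus_iota0 (laurent_is_calculus calcH) _.
rewrite mulNr mulrN -!mulrA (t'_comm y) // (mulrA (gdiff _)) dt_comm // -mulrA.
by rewrite (mulrA (iota t') y) (t'_comm y) // -mulrA.
Qed.

End Laurent.

(** * Completeness of the calculus *)

Theorem theorem4p3p7 (R : realType) (theta : R)
    (* the Hopf algebra H = C[t, t^-1] *)
    (H : algType R[i]) (t t' : H) (laurentH : laurent_algebra t t')
    (hopf : hopf_algebra H)
    (comul_t : comul hopf t = t ⊗ t)
    (counit_t : counit hopf t = 1)
    (antipode_t : antipode hopf t = t')
    (* the noncommutative torus A and its coaction *)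
    (A : algType R[i]) (u u' v v' : A) (torusA : nctorus theta u u' v v')
    (Delta : {lrmorphism A -> A ⊗ H})
    (coactA : right_comodule_algebra hopf Delta)
    (Delta_u : Delta u = u ⊗ t)
    (Delta_v : Delta v = v ⊗ t')
    (* the calculi *)
    (OmA : dgAlgType R[i]) (iotaA : {lrmorphism A -> OmA})
    (calcA : nctorus_calculus theta u v iotaA)
    (OmH : dgAlgType R[i]) (iotaH : {lrmorphism H -> OmH})
    (calcH : laurent_calculus t t' iotaH) :
  complete_calculus Delta iotaA iotaH.
Proof.
have [tt' t't] := laurent_rel laurentH.
have qtorusA : qtorus (K := R[i]) (expi theta) u u' v v'.
  by split; [exact: nctorus_relP torusA | exact: nctorus_univ torusA].
have formsA := nctorus_calculus_forms calcA.
have iotaA0 := forms_deg0 formsA.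
have iotaH0 := diff_calculus_iota0 (laurent_is_calculus calcH).
have [D [DE D0]] := tens_map_lrmorphism iotaA0 iotaH0.
have [j jE] : exists j : {lrmorphism A -> gtens OmA OmH}, forall a, j a = D (Delta a).
  by exists (D \o Delta).
have ju : j u = iotaA u ⊗ iotaH t by rewrite jE Delta_u DE tens_mapE.
have jv : j v = iotaA v ⊗ iotaH t' by rewrite jE Delta_v DE tens_mapE.
have tt'C : iotaH t * iotaH t' = iotaH t' * iotaH t.
  by rewrite -!rmorphM tt' t't.
have formsj : torus_forms (K := R[i]) (expi theta) u v j.
  apply: torus_forms_tensor (laurent_diff_commute laurentH calcH) _ ju jv => //.
  - exact: expi_neq0.
  - exact: qtorusA.
  - by move=> a; rewrite jE.
have [Phi [Phi_dg PhiE]] := free_torus_calculus_universal (expi_neq0 theta)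
  qtorusA formsA (nctorus_calculus_free calcA) formsj.
by exists Phi; split=> // a; rewrite PhiE jE DE.
Qed.
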